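(* The distinguishing number of the folded hypercube $FQ_n$ is $\dist(FQ_n)=2$ if $n=1$; $4$ if $n=2$; $5$ if $n=3$; and $2$ if $n\ge 4$.
   Context: The folded hypercube $FQ_n$ has vertex set $\mathbb{Z}_2^n$, two vertices being adjacent iff they differ in exactly one position or in all $n$ positions. A vertex coloring is distinguishing if the only automorphism preserving every color class is the identity; $\dist(G)$ is the minimum number of colors in a distinguishing coloring of $G$. *)

(* Defs.v *)
From HB Require Import structures.
From mathcomp Require Import all_boot all_fingroup all_algebra.

Set Implicit Arguments.
Unset Strict Implicit.
Unset Printing Implicit Defensive.

Section Distinguishing.

(* A finite graph is given by its adjacency relation. *)
Variables (T : finType) (e : rel T).

Definition automorphism (s : {perm T}) : bool :=
  [forall x, forall y, e (s x) (s y) == e x y].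

(* For a permutation, preserving every color class (setwise) is the same as
   c (s x) = c x for all x. *)
Definition preserves_coloring (C : finType) (c : {ffun T -> C})
    (s : {perm T}) : bool :=
  [forall x, c (s x) == c x].

Definition distinguishing (C : finType) (c : {ffun T -> C}) : bool :=
  [forall s : {perm T},
     automorphism s && preserves_coloring c s ==> (s == 1%g)].

Definition distinguishable (k : nat) : bool :=
  [exists c : {ffun T -> 'I_k}, distinguishing c].

Lemma ex_distinguishable : exists k, distinguishable k.
Proof.
exists #|T|; apply/existsP; exists [ffun x => enum_rank x].
apply/forallP => s; apply/implyP => /andP [_ /forallP sP].
apply/eqP/permP => x; rewrite perm1; apply: enum_rank_inj.
by have /eqP := sP x; rewrite !ffunE.
Qed.

Definition dist : nat := ex_minn ex_distinguishable.

End Distinguishing.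

Definition hamming (n : nat) (x y : 'rV['F_2]_n) : nat :=
  #|[set i : 'I_n | x ord0 i != y ord0 i]|.

Definition FQ (n : nat) : rel 'rV['F_2]_n :=
  fun x y => (hamming x y == 1) || (hamming x y == n).

Lemma FQ_sym (n : nat) : symmetric (@FQ n).
Proof.
move=> x y; rewrite /FQ; suff -> : hamming x y = hamming y x by [].
by apply: eq_card => i; rewrite !inE eq_sym.
Qed.

Lemma FQ_irrefl (n : nat) : 0 < n -> irreflexive (@FQ n).
Proof.
move=> n_gt0 x; rewrite /FQ; suff -> : hamming x x = 0.
  by rewrite orFb eq_sym; apply/negbTE; rewrite -lt0n.
by apply: eq_card0 => i; rewrite !inE eqxx.
Qed.

(* Main.v *)
(** FQ_1 and FQ_2 are complete and FQ_3 is K_{4,4}. For n >= 4 write FQ_n as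
    the Cayley graph of F_2^n on g_0, ..., g_n, the unit vectors followed by
    the all-ones vector. Two vertices at distance 2 have exactly two common
    neighbours, which forces an automorphism s to be affine:
    s(x + g_k) = s(x) + g_{q(k)} for a permutation q. Mark 0, the g_k with
    k > 0, and the g_k + g_{k+1} with k + 1 < n. Among the marked vertices, 0
    is the only one with exactly one unmarked neighbour, namely g_0; so an
    automorphism preserving the marks fixes 0 and g_0, and then, following the
    path g_0 - g_1 - ... - g_{n-1}, all the g_k. *)
Require Import Defs.
From mathcomp Require Import all_boot all_fingroup all_algebra.
From mathcomp Require Import zify.

Set Implicit Arguments.
Unset Strict Implicit.
Unset Printing Implicit Defensive.

Import GRing.Theory.

(** * Distinguishing colorings, twins and complete graphs *)

Section DistinguishingNumber.

Variables (T : finType) (e : rel T).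

Lemma automorphismP (s : {perm T}) :
  reflect (forall x y, e (s x) (s y) = e x y) (automorphism e s).
Proof.
apply: (iffP forallP) => [h x y|h x]; first by have /forallP/(_ y)/eqP := h x.
by apply/forallP => y; rewrite h.
Qed.

Lemma distinguishingP (C : finType) (c : {ffun T -> C}) :
  reflect (forall s : {perm T}, (forall x y, e (s x) (s y) = e x y) ->
             (forall x, c (s x) = c x) -> forall x, s x = x)
          (distinguishing e c).
Proof.
apply: (iffP forallP) => [h s he hc x|h s].
  have /eqP -> : s == 1%g; last by rewrite perm1.
  have /implyP := h s; apply; apply/andP; split; first exact/automorphismP.
  by apply/forallP => y; rewrite hc.
apply/implyP => /andP[/automorphismP he /forallP hc].
by apply/eqP/permP => x; rewrite perm1; apply: h => // y; apply/eqP.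
Qed.

Lemma distE (k : nat) :
  distinguishable e k -> (forall j, distinguishable e j -> k <= j) ->
  dist e = k.
Proof.
by rewrite /dist; case: ex_minnP => m dm m_min dk k_min; apply/eqP;
   rewrite eqn_leq m_min // k_min.
Qed.

Lemma distinguishable_card : distinguishable e #|T|.
Proof.
apply/existsP; exists [ffun x => enum_rank x].
apply/distinguishingP => s _ hc x; apply: enum_rank_inj.
by have := hc x; rewrite !ffunE.
Qed.

(** The transposition of two twins is an automorphism. If they share a color, it preserves the
    coloring, hence is the identity. *)
Lemma distinguishing_twins (C : finType) (c : {ffun T -> C}) (x y : T) :
  symmetric e -> irreflexive e -> distinguishing e c ->
  (forall z, z != x -> z != y -> e x z = e y z) -> c x = c y -> x = y.
Proof.
move=> e_sym e_irr /distinguishingP hc twin cxy.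
rewrite -[RHS](tpermL x y) hc // => [u v|u]; last by case: tpermP => // ->.
have [->|nxy] := eqVneq x y; first by rewrite tperm1 !perm1.
have twin' z : z != x -> z != y -> e z x = e z y.
  by move=> zx zy; rewrite ![e z _]e_sym twin.
case: tpermP => [->|->|/eqP ux /eqP uy]; case: tpermP => [->|->|/eqP vx /eqP vy];
  rewrite ?e_irr //.
- by rewrite twin.
- by rewrite twin.
- by rewrite twin'.
- by rewrite twin'.
Qed.

Lemma dist_complete : (forall x y, e x y = (x != y)) -> dist e = #|T|.
Proof.
move=> eE; apply: distE; first exact: distinguishable_card.
move=> j /existsP[c dc]; rewrite -[j]card_ord; apply: (@leq_card _ _ c) => x y.
apply: distinguishing_twins dc _ => [u v|u|z zx zy].
- by rewrite !eE eq_sym.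
- by rewrite eE eqxx.
- by rewrite !eE ![_ == z]eq_sym zx zy.
Qed.

(** * Balanced complete bipartite graphs *)

Section CompleteBipartite.

Variables (p : pred T) (k : nat).
Hypothesis eE : forall x y, e x y = (p x != p y).
Hypotheses (card_p : #|[set x | p x]| = k.+1)
  (card_np : #|[set x | ~~ p x]| = k.+1).

Lemma card_part (b : bool) : #|[set x | p x == b]| = k.+1.
Proof.
by case: b; [rewrite -card_p | rewrite -card_np]; apply: eq_card => x;
   rewrite !inE; case: (p x).
Qed.

Lemma bipartite_parts_inj (C : finType) (c : {ffun T -> C}) (b : bool) :
  distinguishing e c -> {in [set x | p x == b] &, injective c}.
Proof.
move=> dc x y; rewrite !inE => /eqP px /eqP py.
apply: distinguishing_twins dc _ => [u v|u|z _ _]; rewrite !eE ?eqxx //.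
  by rewrite eq_sym.
by rewrite px py.
Qed.

(** With exactly [k.+1] colors, each part would use every color once. Exchanging equally colored
    vertices across the parts would then be a nontrivial color-preserving involution. *)
Lemma bipartite_colors_gt (j : nat) : distinguishable e j -> k.+1 < j.
Proof.
move=> /existsP[c dc]; have cI b := bipartite_parts_inj (b := b) dc.
have le_kj : k.+1 <= j.
  have := max_card [in c @: [set x | p x == true]].
  by rewrite (card_in_imset (cI true)) card_part card_ord.
rewrite ltn_neqAle le_kj andbT; apply/negP => /eqP ej.
have onto b i : exists2 y, p y = b & c y = i.
  have /subset_leqif_cards[_] : c @: [set x | p x == b] \subset [set: 'I_j].
    exact: subsetT.
  rewrite (card_in_imset (cI b)) card_part cardsT card_ord ej eqxx.
  move=> /esym/eqP cT; have : i \in [set: 'I_j] by [].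
  by rewrite -cT => /imsetP[y]; rewrite inE => /eqP py ->; exists y.
have [s0 s0P] : exists s0, forall x, p (s0 x) = ~~ p x /\ c (s0 x) = c x.
  apply: (fin_all_exists (P := fun x y => p y = ~~ p x /\ c y = c x)) => x.
  by have [y] := onto (~~ p x) (c x); exists y.
have s0K : involutive s0.
  move=> x; have [p1 c1] := s0P x; have [p2 c2] := s0P (s0 x).
  by apply: (cI (p x)); rewrite ?inE ?p2 ?p1 ?negbK ?eqxx // c2 c1.
have /distinguishingP/(_ (perm (inv_inj s0K))) := dc.
have /card_gt0P[x _] : 0 < #|[set x | p x]| by rewrite card_p.
move=> /(_ _ _ x) sx; have := s0P x; rewrite -[s0 x](permE (inv_inj s0K)) sx.
- by case; case: (p x).
- by move=> u v; rewrite !permE !eE !(s0P _).1; case: (p u); case: (p v).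
- by move=> u; rewrite permE (s0P u).2.
Qed.

(** Both parts are numbered from 0 to [k] and colored by rank, except that the last vertex where [p]
    fails gets the extra color [k.+1]. That color prevents a swap of the parts, and ranks identify
    vertices within a part. *)
Lemma bipartite_distinguishable : distinguishable e k.+2.
Proof.
pose part x := enum [set y | p y == p x].
pose rk x := index x (part x).
have in_part x : x \in part x by rewrite mem_enum inE.
have rk_lt x : rk x < k.+1 by rewrite -(card_part (p x)) cardE index_mem in_part.
have rkI x y : p x = p y -> rk x = rk y -> x = y.
  move=> pxy rxy; have eq_part : part y = part x by rewrite /part pxy.
  rewrite -(nth_index x (in_part x)) -/(rk x) rxy /rk eq_part nth_index //.
  by rewrite -eq_part.
pose col x : 'I_k.+2 := inord (if ~~ p x && (rk x == k) then k.+1 else rk x).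
have colE x : col x = (if ~~ p x && (rk x == k) then k.+1 else rk x) :> nat.
  by rewrite inordK //; case: ifP => // _; apply: ltnW; apply: rk_lt.
apply/existsP; exists [ffun x => col x]; apply/distinguishingP => s se sc.
have {}sc x : col (s x) = col x by have := sc x; rewrite !ffunE.
have [x0 px0 rx0] : exists2 x, ~~ p x & rk x = k.
  have /card_gt0P[z] : 0 < #|[set x | ~~ p x]| by rewrite card_np.
  rewrite inE => npz; have sz : k < size (part z).
    by rewrite /part -cardE card_part.
  have := mem_nth z sz; rewrite mem_enum inE (negbTE npz) => /eqP px.
  exists (nth z (part z) k); first by rewrite px.
  have -> : rk (nth z (part z) k) = index (nth z (part z) k) (part z).
    by rewrite /rk /part px (negbTE npz).
  by rewrite index_uniq // enum_uniq.
(* The extra color occurs only in the part of [x0]; once one vertex stays in its part, adjacency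
   keeps all of them there. *)
have ps0 : p (s x0) = p x0.
  have := congr1 val (sc x0); rewrite /= !colE px0 rx0 eqxx (negbTE px0) /=.
  by case: (p (s x0)) => //= h; have := rk_lt (s x0); rewrite h ltnn.
have ps x : p (s x) = p x.
  by have := se x0 x; rewrite !eE ps0; case: (p x0); case: (p x); case: (p _).
move=> x; apply: (rkI _ _ (ps x)).
have := congr1 val (sc x); rewrite /= !colE ps.
case: (~~ p x) => //=; case: eqP => [->|_]; case: eqP => [->|_] // h.
  by have := rk_lt x; rewrite -h ltnn.
by have := rk_lt (s x); rewrite h ltnn.
Qed.

Lemma dist_complete_bipartite : dist e = k.+2.
Proof.
exact: distE bipartite_distinguishable bipartite_colors_gt.
Qed.

End CompleteBipartite.
End DistinguishingNumber.

(** * The folded cube as a Cayley graph: generators and their linear relations *)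

Local Open Scope ring_scope.

Lemma F2_cases (a : 'F_2) : a = 0 \/ a = 1.
Proof.
by case: a => -[|[|m]] lt_m; [left|right|]; [exact: val_inj | exact: val_inj |].
Qed.

Section FoldedCube.

Variable n : nat.
Implicit Types (x y : 'rV['F_2]_n) (i j k : 'I_n.+1).

Lemma addvv x : x + x = 0.
Proof.
apply/rowP => j; rewrite !mxE; apply: val_inj.
by case: (F2_cases (x ord0 j)) => ->.
Qed.

Lemma addvK y : involutive (fun x => x + y).
Proof. by move=> x; rewrite -addrA addvv addr0. Qed.

Lemma addv_eq0 x y : x + y = 0 -> x = y.
Proof. by move=> xy0; rewrite -[x](addvK y) xy0 add0r. Qed.

(** [ord_max] indexes the all-ones vector. Since [lift ord_max j] has the same value as [j], the
    indices below [n] number the unit vectors in order. *)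
Definition gen k : 'rV['F_2]_n :=
  \row_j ((lift ord_max j == k) (+) (ord_max == k))%:R.

Lemma gen_max : gen ord_max = const_mx 1.
Proof.
apply/rowP => j; rewrite !mxE eqxx.
by rewrite eq_sym (negbTE (neq_lift _ _)).
Qed.

Lemma gen_lift (j : 'I_n) : gen (lift ord_max j) = delta_mx 0 j.
Proof.
apply/rowP => l; rewrite !mxE eqxx /= (negbTE (neq_lift _ _)) addbF.
by rewrite (inj_eq lift_inj).
Qed.

Lemma FQ_gen x y : FQ x y <-> exists k, y = x + gen k.
Proof.
rewrite /FQ /hamming; split.
  case/orP => [/cards1P[j /setP hj]|].
    exists (lift ord_max j); rewrite gen_lift; apply/rowP => l.
    have := hj l; rewrite !inE !mxE eqxx /=.
    move=> hl; apply: val_inj; move: hl.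
    case: (F2_cases (x ord0 l)) => ->; case: (F2_cases (y ord0 l)) => ->;
    by case: (l == j).
  move=> h; exists ord_max; rewrite gen_max; apply/rowP => l.
  have : [set i | x ord0 i != y ord0 i] = setT.
    by apply/eqP; rewrite eqEcard subsetT cardsT card_ord (eqP h) leqnn.
  move=> /setP/(_ l); rewrite !inE !mxE => hl; apply: val_inj; move: hl.
  by case: (F2_cases (x ord0 l)) => ->; case: (F2_cases (y ord0 l)) => ->.
case=> k ->; case: (unliftP ord_max k) => [j ->|->]; apply/orP.
  left; apply/cards1P; exists j; apply/setP => l; rewrite gen_lift !inE !mxE.
  by case: (F2_cases (x ord0 l)) => ->; case: (l == j).
right; rewrite gen_max -[X in _ == X]card_ord -cardsT; apply/eqP.
apply: eq_card => l; rewrite !inE !mxE.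
by case: (F2_cases (x ord0 l)) => ->.
Qed.

Lemma sum_genE (s : seq 'I_n.+1) (j : 'I_n) :
  (\sum_(k <- s) gen k) ord0 j =
  (odd (count_mem (lift ord_max j) s) (+) odd (count_mem ord_max s))%:R.
Proof.
elim: s => [|k s IHs]; first by rewrite big_nil mxE.
rewrite big_cons !mxE IHs /= !oddD !oddb ![k == _]eq_sym.
apply: val_inj.
by case: (_ == k); case: (_ == k); case: (odd _); case: (odd _).
Qed.

(* The only linear relations between the [gen k] are 0 and the sum of all
   of them; the latter is excluded as soon as one index is missing. *)
Lemma sum_gen_sub (s t : seq 'I_n.+1) i :
  uniq s -> i \notin s ++ t -> \sum_(k <- s) gen k = \sum_(k <- t) gen k ->
  {subset s <= t}.
Proof.
move=> s_uniq nis st; have st0 : \sum_(k <- s ++ t) gen k = 0.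
  by rewrite big_cat /= st addvv.
(* Coordinate [j] of the vanishing sum compares the multiplicities of [lift ord_max j] and [ord_max]
   modulo 2, so all multiplicities have the same parity. *)
have same k : odd (count_mem k (s ++ t)) = odd (count_mem ord_max (s ++ t)).
  case: (unliftP ord_max k) => [j ->|-> //].
  have := sum_genE (s ++ t) j; rewrite st0 mxE.
  by case: (odd _); case: (odd _).
(* The missing index [i] makes this parity even, while [k] occurs just once in [s]; so it must occur
   in [t]. *)
move=> k ks; have := same k; rewrite -(same i) (count_memPn nis) count_cat oddD.
rewrite (count_uniq_mem _ s_uniq) ks; have [//|kt] := boolP (k \in t).
by rewrite (count_memPn kt).
Qed.

(** At most [n] terms cannot exhaust the [n.+1] indices, so some index is missing. *)
Lemma sum_gen_sub_size (s t : seq 'I_n.+1) :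
  uniq s -> (size s + size t <= n)%N ->
  \sum_(k <- s) gen k = \sum_(k <- t) gen k -> {subset s <= t}.
Proof.
rewrite -size_cat => s_uniq stn.
suff /existsP[i] : [exists i, i \notin s ++ t] by apply: sum_gen_sub.
apply: contraT; rewrite negb_exists => /forallP all_s.
have := leq_trans (card_size (s ++ t)) stn; rewrite (eq_card (B := 'I_n.+1)).
  by rewrite card_ord ltnn.
by move=> k; have := all_s k; rewrite negbK => ->.
Qed.

Lemma gen_ind (P : 'rV['F_2]_n -> Prop) :
  P 0 -> (forall x k, P x -> P (x + gen k)) -> forall x, P x.
Proof.
move=> P0 PD x; rewrite (row_sum_delta x); elim/big_rec: _ => // j y _ Py.
case: (F2_cases (x ord0 j)) => ->; rewrite ?scale0r ?add0r // scale1r addrC.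
by rewrite -gen_lift; apply: PD.
Qed.

Lemma automorphism_translation (y : 'rV['F_2]_n) :
  automorphism (@FQ n) (perm (inv_inj (addvK y))).
Proof.
apply/automorphismP => u v; rewrite !permE.
apply/idP/idP => /FQ_gen[k hk]; apply/FQ_gen; exists k.
  by rewrite -[v](addvK y) hk addrAC addvK.
by rewrite hk addrAC.
Qed.

Hypothesis n_gt3 : (3 < n)%N.

Lemma gen_inj : injective gen.
Proof.
move=> i j ij; have := @sum_gen_sub_size [:: i] [:: j] isT.
rewrite !big_seq1 => /(_ (ltnW (ltnW n_gt3)) ij i).
by rewrite !inE eqxx => /(_ isT)/eqP.
Qed.

Lemma gen_neq0 k : gen k != 0.
Proof.
apply/eqP => k0; have := @sum_gen_sub_size [:: k] [::] isT.
rewrite big_seq1 big_nil => /(_ (ltnW (ltnW (ltnW n_gt3))) k0 k).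
by rewrite !inE eqxx => /(_ isT).
Qed.

Lemma uniq_pair (T : eqType) (a b : T) : a != b -> uniq [:: a; b].
Proof. by rewrite /= inE andbT. Qed.

Lemma gen2_neq_gen i j k : i != j -> gen i + gen j != gen k.
Proof.
move=> ij; apply/eqP => ijk.
have := @sum_gen_sub_size [:: i; j] [:: k] (uniq_pair ij) (ltnW n_gt3).
rewrite !big_cons !big_nil !addr0 => /(_ ijk).
by move/(uniq_leq_size (uniq_pair ij)).
Qed.

(** This is the count of common neighbours at distance 2. It needs four terms to be at most [n]: for
    [n = 3] the four generators sum to 0 and the claim fails. *)
Lemma gen2_eq i j k l :
  gen i + gen j = gen k + gen l -> i != j ->
  (k = i /\ l = j) \/ (k = j /\ l = i).
Proof.
move=> ij_kl ij.
have := @sum_gen_sub_size [:: i; j] [:: k; l] (uniq_pair ij) n_gt3.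
rewrite !big_cons big_nil !addr0 => /(_ ij_kl) h.
move: (h i) (h j) ij; rewrite !inE !eqxx orbT.
move=> /(_ isT)/orP[]/eqP -> /(_ isT)/orP[]/eqP -> //; rewrite ?eqxx //; auto.
Qed.

(** * Automorphisms are affine when [n >= 4] *)

(* The image of x + gen i + gen j is the common neighbour, other than [s x],
   of the images of x + gen i and x + gen j. *)
Lemma automorphism_square (s : {perm 'rV['F_2]_n}) x i j :
  automorphism (@FQ n) s ->
  s (x + gen i + gen j) + s (x + gen j) = s (x + gen i) + s x.
Proof.
move=> /automorphismP se.
have [<-|ij] := eqVneq i j; first by rewrite addvK addrC.
have step y k : exists l, s (y + gen k) = s y + gen l.
  by apply/FQ_gen; rewrite se; apply/FQ_gen; exists k.
have [a sa] := step x i; have [b sb] := step x j.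
have [c sc] := step (x + gen i) j; have [d sd] := step (x + gen j) i.
have ab : a != b.
  apply: contraNneq ij => ab; apply/eqP/gen_inj/(addrI x)/(@perm_inj _ s).
  by rewrite sa sb ab.
have cbda : gen a + gen c = gen b + gen d.
  apply: (addrI (s x)); rewrite !addrA -sa -sb -sc -sd.
  by rewrite addrAC.
(* If [a = c], the image path returns to [s x], and injectivity of [s] forces [i = j]. *)
have [ac|ac] := eqVneq a c.
  have : s (x + gen i + gen j) = s x by rewrite sc sa ac addvK.
  move/perm_inj; rewrite -addrA -[RHS]addr0 => /addrI/addv_eq0/gen_inj.
  by move/eqP; rewrite (negbTE ij).
have [[bE _]|[bc da]] := gen2_eq cbda ac; first by rewrite bE eqxx in ab.
by rewrite sc sa sb -bc [s x + gen b]addrC addrA addvK.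
Qed.

(** The permutation [q] is read off at 0; [automorphism_square] says that [s (x + gen k) + s x] does
    not change when [x] moves along an edge, so [q] serves at every vertex. *)
Lemma automorphism_affine (s : {perm 'rV['F_2]_n}) :
  automorphism (@FQ n) s ->
  exists2 q : 'I_n.+1 -> 'I_n.+1, injective q &
    forall x k, s (x + gen k) = s x + gen (q k).
Proof.
move=> sA; have /automorphismP se := sA.
have [q qP] : exists q : 'I_n.+1 -> 'I_n.+1, forall k, s (gen k) = s 0 + gen (q k).
  apply: (fin_all_exists (P := fun k l => s (gen k) = s 0 + gen l)) => k.
  by apply/FQ_gen; rewrite se; apply/FQ_gen; exists k; rewrite add0r.
exists q => [i j ij|].
  by apply/gen_inj/(@perm_inj _ s); rewrite !qP ij.
apply: gen_ind => [k|x j IHx k]; first by rewrite add0r qP.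
have := automorphism_square x k j sA; rewrite (IHx k) [RHS]addrC addrA addvv.
rewrite add0r => /(congr1 (fun y => y + s (x + gen j))); rewrite addvK.
by rewrite addrAC => ->; rewrite addrC.
Qed.

(** * A distinguishing 2-coloring for [n >= 4] *)

Definition marked x : bool :=
  [|| x == 0, [exists k, (k != ord0) && (x == gen k)] |
      [exists k : 'I_n.+1, [exists l : 'I_n.+1,
         [&& l == k.+1 :> nat, (l < n)%N & x == gen k + gen l]]]].

Lemma markedP x :
  reflect [\/ x = 0, exists2 k, k != ord0 & x = gen k |
            exists k, exists l : 'I_n.+1,
              [/\ l = k.+1 :> nat, (l < n)%N & x = gen k + gen l]]
          (marked x).
Proof.
apply: (iffP or3P).
  case=> [/eqP ->|/existsP[k /andP[k0 /eqP ->]]|/existsP[k /existsP[l]]].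
  - by constructor 1.
  - by constructor 2; exists k.
  - by case/and3P=> /eqP lk ln /eqP ->; constructor 3; exists k, l.
case=> [->|[k k0 ->]|[k [l [lk ln ->]]]].
- by constructor 1.
- by constructor 2; apply/existsP; exists k; rewrite k0 eqxx.
- constructor 3; apply/existsP; exists k; apply/existsP; exists l.
  by rewrite lk -lk ln !eqxx.
Qed.

Lemma marked_gen k : marked (gen k) = (k != ord0).
Proof.
apply/idP/idP => [|k0]; last by apply/markedP; constructor 2; exists k.
case/markedP => [/eqP|[j j0 /gen_inj -> //]|[i [j [ij jn kij]]]].
  by rewrite (negbTE (gen_neq0 k)).
have := @gen2_neq_gen i j k; rewrite -kij eqxx -val_eqE /=; lia.
Qed.

Lemma marked_gen2 i j :
  i != j -> marked (gen i + gen j) -> (j = i.+1 :> nat) \/ (i = j.+1 :> nat).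
Proof.
move=> ij /markedP[/addv_eq0/gen_inj/eqP|[k _ /eqP]|[k [l [kl _]]]].
- by rewrite (negbTE ij).
- by rewrite (negbTE (gen2_neq_gen k ij)).
- by move/gen2_eq => /(_ ij) [] [] <- <-; auto.
Qed.

(* For [n = 4] a sum of three generators is also a sum of two; the edges of
   the path avoid the last index precisely to rule this coincidence out. *)
Lemma marked_gen3 i j k :
  i != j -> (i < n)%N -> (j < n)%N -> k \notin [:: i; j; ord_max] ->
  ~~ marked (gen i + gen j + gen k).
Proof.
move=> ij lt_in lt_jn kB; rewrite !inE !negb_or in kB.
case/and3P: kB => ki kj kn; apply/negP => mijk.
have ijk_uniq : uniq [:: i; j; k].
  by rewrite /= !inE negb_or ij ![_ == k]eq_sym ki kj.
have lt_max (a : 'I_n.+1) : (a < n)%N -> ord_max != a.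
  by move=> an; rewrite -val_eqE /= gtn_eqF.
have [t [t_size t_max tE]] : exists t : seq 'I_n.+1, [/\ (size t < 3)%N,
    ord_max \notin t & gen i + gen j + gen k = \sum_(l <- t) gen l].
  case/markedP: mijk => [->|[l l0 lE]|[l [m [lm mn ->]]]].
  - by exists [::]; rewrite big_nil.
  - case: (eqVneq l ord_max) lE => [-> lE|ln ->].
      have := @sum_gen_sub_size [:: i; j; k] [:: ord_max] ijk_uniq n_gt3.
      rewrite !big_cons !big_nil !addr0 !addrA => /(_ lE).
      by move/(uniq_leq_size ijk_uniq).
    by exists [:: l]; rewrite ?big_seq1 ?inE ?[ord_max == l]eq_sym.
  - exists [:: l; m]; rewrite ?big_cons ?big_nil ?addr0 //.
    by rewrite !inE !negb_or !lt_max //; lia.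
(* The two sides may have five terms in total, too many for the size criterion when [n = 4];
   [ord_max] is supplied as the missing index instead. *)
have := @sum_gen_sub [:: i; j; k] t ord_max ijk_uniq.
rewrite mem_cat (negbTE t_max) !inE orbF !negb_or (lt_max i) ?(lt_max j) // eq_sym kn.
rewrite !big_cons !big_nil !addr0 !addrA => /(_ isT tE).
by move/(uniq_leq_size ijk_uniq); rewrite leqNgt t_size.
Qed.

(** At most three of the [n.+1 >= 5] directions from a nonzero marked vertex lead to marked
    vertices; [B] lists the candidates. *)
Lemma card_unmarked_neighbors x :
  marked x -> x != 0 -> (1 < #|[set k | ~~ marked (x + gen k)]|)%N.
Proof.
move=> mx x0.
have [B sB mB] : exists2 B : seq 'I_n.+1, (size B <= 3)%N &
    forall k, k \notin B -> ~~ marked (x + gen k).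
  case/markedP: mx => [xE|[i i0 ->]|[i [j [ij jn ->]]]].
  - by rewrite xE eqxx in x0.
  - exists [:: i; inord i.-1; inord i.+1] => // k kB.
    rewrite !inE !negb_or in kB; case/and3P: kB => ki kp ks; apply/negP => mik.
    have ik : i != k by rewrite eq_sym.
    case: (marked_gen2 ik mik) => [kE|iE].
      by rewrite -kE inord_val eqxx in ks.
    by rewrite iE inord_val eqxx in kp.
  - exists [:: i; j; ord_max] => // k; apply: marked_gen3 => //; last by lia.
    by rewrite -val_eqE /=; lia.
have : (#|'I_n.+1| <= #|[set k | ~~ marked (x + gen k)]| + size B)%N.
  apply: leq_trans (leq_add (leqnn _) (card_size B)).
  rewrite -(cardsE [in B]) -cardUI.
  apply: leq_trans (leq_addr _ _); rewrite -cardsT subset_leq_card //.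
  apply/subsetP => k _; rewrite !inE.
  by have := mB k; case: (k \in B) => [|->] //; rewrite orbT.
by rewrite card_ord; lia.
Qed.

Lemma card_unmarked_neighbors0 : #|[set k | ~~ marked (0 + gen k)]| = 1%N.
Proof.
by apply/eqP/cards1P; exists ord0; apply/setP => k; rewrite !inE add0r
   marked_gen negbK.
Qed.

Lemma distinguishing_marked :
  distinguishing (@FQ n) [ffun x => marked x].
Proof.
apply/distinguishingP => s /automorphismP sA smarked.
have [q qI sq] := automorphism_affine sA.
have {}smarked x : marked (s x) = marked x.
  by have := smarked x; rewrite !ffunE.
have s0 : s 0 = 0.
  apply/eqP; apply: contraT => s0.
  have /card_unmarked_neighbors/(_ s0) : marked (s 0).
    by rewrite smarked; apply/markedP; constructor 1.
  (* [q] matches the unmarked directions at 0 with those at [s 0], so [s 0] would have only one. *)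
  rewrite -[X in (X < _)%N]card_unmarked_neighbors0 ltnNge.
  rewrite -[X in (_ <= X)%N](card_imset _ qI) => /negP[].
  apply: subset_leq_card; apply/subsetP => k; rewrite inE => mk.
  have [r _ qK] := injF_bij qI; rewrite -[k]qK mem_imset // inE -smarked sq.
  by rewrite qK.
have sg k : s (gen k) = gen (q k) by rewrite -[gen k]add0r sq s0 add0r.
have q0 : q ord0 = ord0.
  apply/eqP/negbFE; rewrite -marked_gen -sg smarked marked_gen eqxx //.
have q_lt (m : nat) k : k = m :> nat -> (m < n)%N -> q k = k.
  elim/ltn_ind: m k => -[|m] IHm k km mn.
    by rewrite (_ : k = ord0) //; apply: val_inj.
  have lt_m : (m < n.+1)%N by lia.
  pose l := Ordinal lt_m.
  have ql : q l = l by apply: (IHm m) => //; lia.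
  (* This is the image of the path edge from [l] to [k], so [q k] is a path neighbour of [l]. *)
  have : marked (gen l + gen (q k)).
    rewrite -[X in gen X + _]ql -sg -sq smarked; apply/markedP; constructor 3.
    by exists l, k; rewrite km.
  have lqk : l != q k.
    by rewrite -[X in X != _]ql (inj_eq qI) -val_eqE /=; lia.
  case/(marked_gen2 lqk) => e.
    by apply: val_inj; rewrite /= e /= -km.
  (* Here [q k] precedes [l], hence is already fixed by [q], and injectivity gives [q k = k]. *)
  apply: qI; apply: (IHm (q k)) => //; move: e => /=; lia.
have qid k : q k = k.
  have [kn|kn] := ltnP k n; first exact: q_lt kn.
  have [qn|qn] := ltnP (q k) n; first by apply: qI; apply: q_lt qn.
  by apply: val_inj => /=; have := ltn_ord k; have := ltn_ord (q k); lia.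
by apply: gen_ind => // x k IHx; rewrite sq IHx qid.
Qed.

(** Under a single color, translation by [gen ord0] is a nontrivial color-preserving
    automorphism. *)
Lemma FQ_colors_gt1 (j : nat) :
  distinguishable (@FQ n) j -> (1 < j)%N.
Proof.
case: j => [|[|//]] /existsP[c dc]; first by case: (c 0).
have /distinguishingP := dc.
move=> /(_ _ (automorphismP _ _ (automorphism_translation (gen ord0)))) h.
have := h _ 0; rewrite permE add0r => g0.
by have := gen_neq0 ord0; rewrite g0 ?eqxx // => x; rewrite !ord1.
Qed.

Lemma dist_FQ_large : dist (@FQ n) = 2.
Proof.
apply: distE FQ_colors_gt1.
apply/existsP; exists [ffun x => inord (marked x)].
apply/distinguishingP => s sA sc.
have /distinguishingP := distinguishing_marked; apply=> // x.
have := congr1 val (sc x); rewrite !ffunE /= !inordK ?ltnS ?leq_b1 //.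
by case: (marked x); case: (marked _).
Qed.

End FoldedCube.

(** * The cases [n <= 3] *)

Lemma card_F2_row (n : nat) : #|{: 'rV['F_2]_n}| = (2 ^ n)%N.
Proof. by rewrite card_mx mul1n card_ord. Qed.

Lemma hamming_eq0 (n : nat) (x y : 'rV['F_2]_n) : (hamming x y == 0%N) = (x == y).
Proof.
rewrite cards_eq0; apply/eqP/eqP => [/setP xy|->].
  by apply/rowP => i; have := xy i; rewrite !inE => /negbFE/eqP.
by apply/setP => i; rewrite !inE eqxx.
Qed.

Lemma hamming_leq (n : nat) (x y : 'rV['F_2]_n) : (hamming x y <= n)%N.
Proof. by rewrite -[X in (_ <= X)%N]card_ord max_card. Qed.

(** The distances 1 and [n] are then all the nonzero ones, so the graph is complete. *)
Lemma dist_FQ_le2 (n : nat) : (0 < n <= 2)%N -> dist (@FQ n) = (2 ^ n)%N.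
Proof.
move=> n12; rewrite dist_complete ?card_F2_row // => x y.
rewrite /FQ -hamming_eq0; have := hamming_leq x y; lia.
Qed.

Definition even_weight (x : 'rV['F_2]_3) : bool := \sum_i x ord0 i == 0.

(** In dimension 3 the admissible distances 1 and 3 are exactly the odd ones. *)
Lemma FQ3_bipartite (x y : 'rV['F_2]_3) :
  FQ x y = (even_weight x != even_weight y).
Proof.
rewrite /FQ /hamming /even_weight -sum1_card big_mkcond /=.
rewrite !big_ord_recl !big_ord0 !inE.
by do 3![move: (x ord0 _) (y ord0 _) => a b;
         case: (F2_cases a) => ->; case: (F2_cases b) => -> {a b}].
Qed.

Lemma even_weight_shift (x : 'rV['F_2]_3) :
  even_weight (x + delta_mx 0 0) = ~~ even_weight x.
Proof.
rewrite /even_weight !big_ord_recl !big_ord0 !mxE /= !addr0.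
by case: (F2_cases (x 0 0)) => ->; do 2![move: (x 0 _) => a;
   case: (F2_cases a) => -> {a}].
Qed.

Lemma card_even_weight :
  #|[set x | even_weight x]| = 4 /\ #|[set x | ~~ even_weight x]| = 4.
Proof.
(* Flipping coordinate 0 exchanges the two parities, so each class holds half of the 8 vectors. *)
have oddE : [set x | ~~ even_weight x] =
    (fun x => x + delta_mx 0 0) @: [set x | even_weight x].
  apply/setP => x; rewrite -[x](addvK (delta_mx 0 0)) (mem_imset _ _ (addIr _)).
  by rewrite !inE even_weight_shift negbK.
have := card_F2_row 3; rewrite -(cardC [set x | even_weight x]).
have -> : #|[predC [set x | even_weight x]]| = #|[set x | ~~ even_weight x]|.
  by apply: eq_card => x; rewrite !inE.
by rewrite oddE (card_imset _ (addIr _)) addnn => /(@double_inj _ 4).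
Qed.

Lemma dist_FQ3 : dist (@FQ 3) = 5.
Proof.
have [ce co] := card_even_weight.
exact: dist_complete_bipartite FQ3_bipartite ce co.
Qed.

Local Close Scope ring_scope.

Theorem theorem5p7 (n : nat) (hn : 1 <= n) :
  dist (@FQ n) = match n with
                 | 1 => 2
                 | 2 => 4
                 | 3 => 5
                 | _ => 2
                 end.
Proof.
case: n hn => [//|[|[|[|n]]]] _.
- exact: dist_FQ_le2.
- exact: dist_FQ_le2.
- exact: dist_FQ3.
- exact: dist_FQ_large.
Qed.
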